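(* Let $T(n)$ denote the number of fixed polyiamonds with $n$ cells. If $\ell,m\ge 1$ are positive integers that are not both equal to $1$, then $T(\ell+m)\ge T(\ell)\,T(m)$.
   Context: The triangular lattice is the tiling of the plane by equilateral triangles; its cells come in two orientations. A polyiamond with $n$ cells is a finite set of $n$ cells of the triangular lattice that is edge-connected, i.e. the graph on the cells in which two cells are adjacent when they share an edge is connected. Two polyiamonds are considered the same if one is a translate of the other (no rotations or reflections allowed); $T(n)$ is the number of such translation classes of polyiamonds with $n$ cells. For example $T(1)=2$, $T(2)=3$, $T(3)=6$. *)

(* Defs.v *)
From mathcomp Require Import all_boot all_order all_algebra.
From mathcomp Require Import finmap.
From Stdlib Require Import ClassicalEpsilon.

Set Implicit Arguments.
Unset Strict Implicit.
Unset Printing Implicit Defensive.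

Local Open Scope fset_scope.

(* A cell of the triangular lattice, in lattice coordinates (x, y) with
   basis vectors e1 = (1,0), e2 = (1/2, sqrt 3/2):
   (x, y, false) = "up" triangle with vertices (x,y), (x+1,y), (x,y+1);
   (x, y, true)  = "down" triangle with vertices (x+1,y), (x,y+1), (x+1,y+1). *)
Definition cell := (int * int * bool)%type.

(* Two cells are adjacent iff they share an edge. *)
Definition adj_up_down (u d : int * int) : bool :=
  [|| d == u, d == (u.1 - 1, u.2)%R | d == (u.1, u.2 - 1)%R].

Definition adj (c d : cell) : bool :=
  match c, d with
  | (xc, yc, false), (xd, yd, true) => adj_up_down (xc, yc) (xd, yd)
  | (xc, yc, true), (xd, yd, false) => adj_up_down (xd, yd) (xc, yc)
  | _, _ => false
  end.

Definition edge_connected (P : {fset cell}) : Prop :=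
  forall a b, a \in P -> b \in P ->
    exists p : seq cell, [/\ path adj a p, last a p = b & all (fun c => c \in P) p].

Definition polyiamond (n : nat) (P : {fset cell}) : Prop :=
  #|` P| = n /\ edge_connected P.

Definition shift (a b : int) (c : cell) : cell := ((c.1.1 + a)%R, (c.1.2 + b)%R, c.2).

Definition translate (a b : int) (P : {fset cell}) : {fset cell} :=
  [fset shift a b c | c in P].

Definition transl_equiv (P Q : {fset cell}) : Prop :=
  exists a b : int, Q = translate a b P.

Definition num_classes_is (n k : nat) : Prop :=
  exists f : 'I_k -> {fset cell},
    [/\ forall i, polyiamond n (f i),
        forall i j, transl_equiv (f i) (f j) -> i = j
      & forall P, polyiamond n P -> exists i, transl_equiv P (f i)].

(* T(n): the number of fixed polyiamonds with n cells (this number exists and is unique). *)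
Definition T (n : nat) : nat := epsilon (inhabits 0%N) (num_classes_is n).

(* Main.v *)
(* Order the cells strip by strip (a strip is the set of cells with a given x)
   and by height inside a strip. An up cell has its third neighbour in the
   previous strip, a down cell in the next one. Let u be the greatest cell of P
   and v the least cell of Q. If the last strip of P contains a down cell and the
   first strip of Q an up cell, Q is glued to the right of P; if u is up and v is
   down, Q is glued on top of u. There are two other cases, in which P and Q are
   made to overlap in one cell and an extra cell keeps the total at l + m:
   - u is down and all cells of Q in its first strip are down: identify v with u
     and add the up cell just above u;
   - v is up and all cells of P in its last strip are up: identify u with v and
     add the down cell just below the lowest cell of P in that strip.
   Cutting the result after its first l cells reveals which case occurred and
   recovers P and Q. In the last case with l > 1, either the first l cells are
   disconnected, or both cells at the cut are up and lie in the same strip; hence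
   it is not confused with the others. For l = 1 < m, exchange l and m. *)
Require Import Defs.
From mathcomp Require Import all_boot all_order all_algebra finmap zify.
From Stdlib Require Import ClassicalEpsilon.

Set Implicit Arguments.
Unset Strict Implicit.
Unset Printing Implicit Defensive.

Import Order.TTheory GRing.Theory Num.Theory.
Local Open Scope fset_scope.

(** * The strip order on cells *)

(* Twice the row, plus 1 for a down cell: consecutive heights in a strip are
   adjacent cells. *)
Definition height (c : cell) : int := (2 * c.1.2 + Posz c.2)%R.

Definition cle (c d : cell) : bool :=
  (c.1.1 < d.1.1)%R || ((c.1.1 == d.1.1) && (height c <= height d)%R).

Lemma cle_total : total cle.
Proof. move=> [[x y] b] [[x' y'] b']; rewrite /cle /height /=; lia. Qed.

Lemma cle_trans : transitive cle.
Proof. move=> [[x y] b] [[x' y'] b'] [[x2 y2] b2]; rewrite /cle /height /=; lia. Qed.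

Lemma cle_anti : antisymmetric cle.
Proof.
move=> [[x y] b] [[x' y'] b']; rewrite /cle /height /= => H.
by congr (_, _, _); lia.
Qed.

(** Sorting puts such a cell first. The relation is left general so that the reversed order yields
    greatest cells. *)
Lemma fset_least (r : rel cell) (P : {fset cell}) (c : cell) :
  total r -> transitive r -> c \in P ->
  exists2 m, m \in P & {in P, forall d, r m d}.
Proof.
move=> rt rtr cP; have := sort_sorted rt P.
case E: (sort r P) => [|m s] /= ms; first by rewrite -(mem_sort r) E in cP.
exists m => [|d]; first by rewrite -(mem_sort r) E mem_head.
rewrite -(mem_sort r) E inE => /predU1P[->|ds]; first by have := rt m m; rewrite orbb.
exact: (allP (order_path_min rtr ms)).
Qed.

(** * Adjacency and translations *)

Lemma adj_sym : symmetric adj.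
Proof. by move=> [[x y] []] [[x' y'] []]. Qed.

Lemma adj_shift a b c d : adj (shift a b c) (shift a b d) = adj c d.
Proof.
move: c d => [[x y] []] [[x' y'] []] //=; rewrite /adj_up_down /= !xpair_eqE /=; lia.
Qed.

Lemma shiftK a b : cancel (shift a b) (shift (- a) (- b)).
Proof. by move=> [[x y] c]; rewrite /shift /= !addrK. Qed.

Lemma shiftNK a b : cancel (shift (- a) (- b)) (shift a b).
Proof. by move=> [[x y] c]; rewrite /shift /= !subrK. Qed.

Lemma shift_eq a b c d : (shift (- a) (- b) c == d) = (c == shift a b d).
Proof. exact: (can2_eq (shiftNK a b) (shiftK a b)). Qed.

Lemma mem_translate a b c (P : {fset cell}) :
  (c \in translate a b P) = (shift (- a) (- b) c \in P).
Proof.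
apply/imfsetP/idP => [[d /= dP ->]|cP]; first by rewrite shiftK.
by exists (shift (- a) (- b) c) => //; rewrite shiftNK.
Qed.

Lemma mem_shift_translate a b c (P : {fset cell}) :
  (shift a b c \in translate a b P) = (c \in P).
Proof. by rewrite mem_translate shiftK. Qed.

Lemma card_translate a b (P : {fset cell}) : #|` translate a b P| = #|` P|.
Proof. exact: card_imfset (can_inj (shiftK a b)). Qed.

Lemma translate0 (P : {fset cell}) : translate 0 0 P = P.
Proof. by apply/fsetP => -[[x y] c]; rewrite mem_translate /shift /= !subr0. Qed.

Lemma translateD a b a' b' (P : {fset cell}) :
  translate a b (translate a' b' P) = translate (a' + a) (b' + b) P.
Proof.
apply/fsetP => -[[x y] c]; rewrite !mem_translate /shift /=.
by congr (_ \in P); congr (_, _, _); lia.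
Qed.

Lemma translateK a b (P : {fset cell}) : translate (- a) (- b) (translate a b P) = P.
Proof. by rewrite translateD !subrr translate0. Qed.

Lemma transl_equiv_sym P Q : transl_equiv P Q -> transl_equiv Q P.
Proof. by move=> [a [b ->]]; exists (- a)%R, (- b)%R; rewrite translateK. Qed.

Lemma transl_equiv_trans P Q R :
  transl_equiv P Q -> transl_equiv Q R -> transl_equiv P R.
Proof.
by move=> [a [b ->]] [a' [b' ->]]; exists (a + a')%R, (b + b')%R; rewrite translateD.
Qed.

(** * Connectedness and unions *)

(** Only the cells after [a] must lie in [P], as in [edge_connected]; reversing a path therefore
    requires [a \in P]. *)
Definition linked (P : {fset cell}) (a b : cell) : Prop :=
  exists p : seq cell, [/\ path adj a p, last a p = b & all (fun c => c \in P) p].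

Lemma linked_trans P a b c : linked P a b -> linked P b c -> linked P a c.
Proof.
move=> [p [pp pb pP]] [q [qp qc qP]]; exists (p ++ q).
by rewrite cat_path last_cat all_cat pp pb qp qc pP qP.
Qed.

Lemma linked_sym P a b : a \in P -> linked P a b -> linked P b a.
Proof.
move=> aP [p [pp pb pP]]; exists (rev (belast a p)); split.
- by rewrite -pb rev_path (eq_path (e' := adj)) // => x y; rewrite adj_sym.
- by case: p {pp pP} pb => [<-|c p _] //=; rewrite rev_cons last_rcons.
- rewrite all_rev; apply/allP => c /mem_belast; rewrite inE => /predU1P[->//|].
  exact: (allP pP).
Qed.

Lemma linked_sub P R a b : P `<=` R -> linked P a b -> linked R a b.
Proof.
move=> /fsubsetP PR [p [pp pb pP]]; exists p; split=> //.
by apply/allP => c /(allP pP)/PR.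
Qed.

Lemma edge_connected1 c : edge_connected [fset c].
Proof. by move=> a b /fset1P -> /fset1P ->; exists [::]. Qed.

(** Every cell is linked to the hub [c]. The alternative [c == d] covers pieces that overlap,
    [adj c d] pieces that touch. *)
Lemma edge_connectedU P Q c d : edge_connected P -> edge_connected Q ->
  c \in P -> d \in Q -> (c == d) || adj c d -> edge_connected (P `|` Q).
Proof.
move=> Pc Qc cP dQ cd.
have hub a : a \in P `|` Q -> linked (P `|` Q) c a.
  case/fsetUP => [aP|aQ].
    by apply: linked_sub (fsubsetUl _ _) _; apply: Pc.
  apply: (@linked_trans _ _ d).
    case/predU1P: cd => [->|cd]; first by exists [::].
    by exists [:: d]; rewrite /= cd inE dQ orbT.
  by apply: linked_sub (fsubsetUr _ _) _; apply: Qc.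
move=> a b aR bR; apply: (@linked_trans _ _ c); last exact: hub.
by apply: linked_sym (hub _ aR); rewrite inE cP.
Qed.

Lemma edge_connected_translate a b P :
  edge_connected P -> edge_connected (translate a b P).
Proof.
move=> Pc c d; rewrite !mem_translate => cP dP.
have [p [pp pd pP]] := Pc _ _ cP dP.
exists (map (shift a b) p); split.
- rewrite -[c](shiftNK a b) path_map (eq_path (e' := adj)) // => x y.
  exact: adj_shift.
- by rewrite -[c in last c](shiftNK a b) last_map pd shiftNK.
- by rewrite all_map; apply: sub_all pP => x /=; rewrite mem_shift_translate.
Qed.

Lemma edge_connected_translateE a b P :
  edge_connected (translate a b P) <-> edge_connected P.
Proof.
split=> [Pc|]; last exact: edge_connected_translate.
by rewrite -[P](translateK a b); apply: edge_connected_translate.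
Qed.

Lemma polyiamond_translate n a b P : polyiamond n P -> polyiamond n (translate a b P).
Proof.
move=> [<- Pc]; split; first exact: card_translate.
exact: edge_connected_translate.
Qed.

(** * Extreme cells and strips *)

Definition greatest (u : cell) (P : {fset cell}) : Prop :=
  u \in P /\ {in P, forall c, cle c u}.

Definition least (v : cell) (P : {fset cell}) : Prop :=
  v \in P /\ {in P, forall c, cle v c}.

Definition column (x : int) (P : {fset cell}) : {fset cell} :=
  [fset c in P | c.1.1 == x].

Lemma mem_column x P c : (c \in column x P) = (c \in P) && (c.1.1 == x).
Proof. by rewrite !inE. Qed.

Lemma exists_greatest P c : c \in P -> exists u, greatest u P.
Proof.
have ge_total : total (fun a b => cle b a) by move=> a b; exact: cle_total.
have ge_trans : transitive (fun a b => cle b a).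
  by move=> a b d ba db; exact: cle_trans db ba.
by move=> /(fset_least ge_total ge_trans)[u uP uM]; exists u.
Qed.

Lemma exists_least P c : c \in P -> exists v, least v P.
Proof. by move=> /(fset_least cle_total cle_trans)[u uP uM]; exists u. Qed.

Lemma cle_shift a b c d : cle (shift a b c) (shift a b d) = cle c d.
Proof.
by case: c d => [[x y] s] [[x' y'] s']; rewrite /cle /height /=; lia.
Qed.

Lemma greatest_translate a b u P :
  greatest u P -> greatest (shift a b u) (translate a b P).
Proof.
move=> [uP uM]; split; first by rewrite mem_shift_translate.
by move=> c; rewrite mem_translate => /uM; rewrite -(cle_shift a b) shiftNK.
Qed.

Lemma least_translate a b u P :
  least u P -> least (shift a b u) (translate a b P).
Proof.
move=> [uP uM]; split; first by rewrite mem_shift_translate.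
by move=> c; rewrite mem_translate => /uM; rewrite -(cle_shift a b) shiftNK.
Qed.

Lemma least_uniq u v P : least u P -> least v P -> u = v.
Proof. by move=> [uP uM] [vP vM]; apply: cle_anti; rewrite uM ?vM. Qed.

Lemma greatest_uniq u v P : greatest u P -> greatest v P -> u = v.
Proof. by move=> [uP uM] [vP vM]; apply: cle_anti; rewrite uM ?vM. Qed.

Lemma column_translate a b x P :
  column (x + a) (translate a b P) = translate a b (column x P).
Proof.
apply/fsetP => -[[x' y] s]; rewrite mem_column !mem_translate mem_column /=.
by congr andb; lia.
Qed.

(** * Cutting a set after its first cells *)

(** Every cell of [F] strictly precedes every cell of [L], so [F] consists of the first [l] cells of
    [R]. *)
Definition cut (l : nat) (R F L : {fset cell}) (u v : cell) : Prop :=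
  [/\ R = F `|` L, #|` F| = l, greatest u F, least v L & ~~ cle v u].

Lemma cut_initial l R F L u v c : cut l R F L u v -> (c \in F) = (c \in R) && cle c u.
Proof.
move=> [-> _ [uF uM] [vL vM] uv]; rewrite inE.
apply/idP/andP => [cF|[/orP[//|cL] cu]]; first by rewrite cF uM.
by case/negP: uv; apply: cle_trans cu; apply: vM.
Qed.

Lemma cut_final l R F L u v : cut l R F L u v -> L = R `\` F.
Proof.
move=> C; apply/fsetP => c; rewrite inE (cut_initial c C).
have [-> _ [uF uM] [vL vM] uv] := C; rewrite inE.
have [cF|cF] /= := boolP (c \in F).
  by rewrite (uM _ cF) /=; apply/negP => /vM /cle_trans/(_ (uM _ cF)); apply/negP.
case cL: (c \in L) => //=; rewrite ?andbF ?andbT //; apply/esym/negP => cu.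
by case/negP: uv; apply: cle_trans cu; apply: vM.
Qed.

(** Initial segments of a total order are nested, so two of the same size coincide. *)
Lemma cut_uniq l R F L u v F' L' u' v' :
  cut l R F L u v -> cut l R F' L' u' v' -> [/\ F = F', L = L', u = u' & v = v'].
Proof.
wlog uu' : F L u v F' L' u' v' / cle u u'.
  move=> W C C'; case/orP: (cle_total u u') => [|] uu'; first exact: W uu' C C'.
  by have [-> -> -> ->] := W _ _ _ _ _ _ _ _ uu' C' C.
move=> C C'; have FF' : F = F'.
  apply/eqP; rewrite eqEfcard; have [_ -> _ _ _] := C; have [_ -> _ _ _] := C'.
  rewrite leqnn andbT; apply/fsubsetP => c.
  by rewrite (cut_initial c C) (cut_initial c C') => /andP[-> /cle_trans]; apply.
have LL' : L = L' by rewrite (cut_final C) (cut_final C') FF'.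
subst F' L'; case: C C' => [_ _ uF vL _] [_ _ u'F v'L _].
by split=> //; [exact: greatest_uniq uF u'F | exact: least_uniq vL v'L].
Qed.

Lemma cut_card l R F L u v : cut l R F L u v -> #|` R| = (l + #|` L|)%N.
Proof.
move=> C; have [RE FE _ _ _] := C; rewrite RE cardfsU FE.
suff -> : F `&` L = fset0 by rewrite cardfs0 subn0.
by rewrite (cut_final C) fsetIDA fsetDIl fsetDv fset0I.
Qed.

Lemma cut_translate a b l R F L u v : cut l R F L u v ->
  cut l (translate a b R) (translate a b F) (translate a b L) (shift a b u) (shift a b v).
Proof.
move=> [-> <- uF vL uv]; split; rewrite ?card_translate ?cle_shift //.
- by apply/fsetP => c; rewrite !(mem_translate, inE).
- exact: greatest_translate.
- exact: least_translate.
Qed.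

(** * Decoding and its uniqueness *)

(* P and Q are recovered from the two parts F, L into which R is cut; the side
   conditions of the constructors make the three cases exclusive. *)
Inductive decodes (l : nat) (R P Q : {fset cell}) : Prop :=
| DecodesApart u v : cut l R P Q u v -> edge_connected P ->
    (u.1.1 != v.1.1) || (~~ u.2 && v.2) -> decodes l R P Q
| DecodesShareMax L u v : cut l R P L u v -> edge_connected P ->
    u.1.1 = v.1.1 -> u.2 -> ~~ v.2 -> Q = u |` (L `\ v) -> decodes l R P Q
| DecodesShareMin F u v e : cut l R F Q u v ->
    ~ edge_connected F \/ [/\ u.1.1 = v.1.1, ~~ u.2 & ~~ v.2] ->
    least e (column v.1.1 F) -> P = v |` (F `\ e) -> decodes l R P Q.

Lemma translate_swap a b u v (L : {fset cell}) :
  translate a b (u |` (L `\ v)) = shift a b u |` (translate a b L `\ shift a b v).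
Proof. by apply/fsetP => c; rewrite !(mem_translate, inE) !shift_eq. Qed.

(** Needed to pass from a glued polyiamond to the chosen representative of its translation class. *)
Lemma decodes_translate a b l R P Q : decodes l R P Q ->
  decodes l (translate a b R) (translate a b P) (translate a b Q).
Proof.
have col (x y : int) : (x + a == y + a)%R = (x == y) by lia.
case=> [u v C Pc uv | L u v C Pc uv u2 v2 -> | F u v e C FD eF ->].
- apply: DecodesApart (cut_translate a b C) _ _; last by rewrite /= col.
  exact: edge_connected_translate.
- apply: DecodesShareMax (cut_translate a b C) _ _ u2 v2 _.
  + exact: edge_connected_translate.
  + by rewrite /= uv.
  + exact: translate_swap.
- apply: (@DecodesShareMin _ _ _ _ _ _ _ (shift a b e) (cut_translate a b C)).
  + case: FD => [Fn|[uv u2 v2]]; last by right; rewrite /= uv.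
    by left; rewrite edge_connected_translateE.
  + by rewrite /= column_translate; apply: least_translate.
  + exact: translate_swap.
Qed.

(** Both decodings use the same cut. Of the nine pairs of cases, the six mixed ones conflict in
    strip, orientation or connectedness of the first part. *)
Lemma decodes_uniq l R P Q P' Q' :
  decodes l R P Q -> decodes l R P' Q' -> P = P' /\ Q = Q'.
Proof.
case=> [u v C Pc uv | L u v C Pc uv u2 v2 E | F u v e C FD eF E];
  case=> [u' v' C' Pc' uv' | L' u' v' C' Pc' uv' u2' v2' E' | F' u' v' e' C' FD' eF' E'];
  have [? ? ? ?] := cut_uniq C C'; clear C C'; subst.
- by [].
- by move: uv; rewrite uv' u2' eqxx.
- by case: FD' => [//|[uv' u2' v2']]; move: uv; rewrite uv' eqxx u2' (negPf v2').
- by move: uv'; rewrite uv u2 eqxx.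
- by [].
- by case: FD' => [//|[uv' u2' v2']]; rewrite u2 in u2'.
- by case: FD => [//|[uv u2 v2]]; move: uv'; rewrite uv eqxx u2 (negPf v2).
- by case: FD => [//|[uv u2 v2]]; rewrite u2' in u2.
- by rewrite (least_uniq eF eF').
Qed.

(** * The three constructions *)

Lemma cle_column c d d' : cle c d -> cle d d' -> c.1.1 = d'.1.1 -> d.1.1 = d'.1.1.
Proof. by rewrite /cle; lia. Qed.

(** A down cell has two neighbours in its own strip; the third lies in the next strip and is
    greater. *)
Lemma adj_cle_column c d : adj c d -> c.2 -> cle d c -> d.1.1 = c.1.1.
Proof.
case: c d => [[x y] []] [[x' y'] []] //=.
by rewrite /cle /height /adj_up_down !xpair_eqE /=; lia.
Qed.

Lemma decodes_glue P Q u v p q : edge_connected P -> edge_connected Q ->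
  greatest u P -> least v Q -> ~~ cle v u ->
  (u.1.1 != v.1.1) || (~~ u.2 && v.2) ->
  p \in P -> q \in Q -> adj p q ->
  exists2 R, polyiamond (#|` P| + #|` Q|) R & decodes #|` P| R P Q.
Proof.
move=> Pc Qc uP vQ uv sep pP qQ pq.
have C : cut #|` P| (P `|` Q) P Q u v by split.
exists (P `|` Q); last exact: DecodesApart C Pc sep.
split; first exact: cut_card C.
by apply: edge_connectedU pP qQ _ => //; rewrite pq orbT.
Qed.

Lemma decodes_share_max P Q u : edge_connected P -> edge_connected Q ->
  greatest u P -> least u Q -> u.2 -> {in column u.1.1 Q, forall c : cell, c.2} ->
  exists2 R, polyiamond (#|` P| + #|` Q|) R & decodes #|` P| R P Q.
Proof.
move=> Pc Qc uP uQ u2 Qcol.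
pose w : cell := (u.1.1, u.1.2 + 1, false)%R.
have uw : adj u w.
  move: u2; rewrite /w; case: (u) => [[x y] []] //= _.
  by rewrite /adj_up_down !xpair_eqE /=; lia.
have wu : ~~ cle w u by rewrite /w /cle /height /= u2; case: (u) => [[x y] ?] /=; lia.
have wP : w \notin P by apply/negP => /(proj2 uP); apply/negP.
have wQ : w \notin Q.
  by apply/negP => wQ; have := Qcol w; rewrite mem_column wQ eqxx => /(_ isT).
have wL : least w (w |` (Q `\ u)).
  split=> [|c]; first exact: fset1U1.
  rewrite !inE => /predU1P[->|/andP[cu cQ]]; first by have := cle_total w w; rewrite orbb.
  (* Other cells of [Q] in this strip are down and above [u], hence at least two heights higher,
     while [w] is one higher. *)
  have := proj2 uQ _ cQ; move: cu; rewrite /w /cle /height /=.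
  by move: u2; case: (u) (c) => [[x y] []] [[x' y'] []] //= _; rewrite !xpair_eqE; lia.
have C : cut #|` P| (P `|` (w |` (Q `\ u))) P (w |` (Q `\ u)) u w by split.
exists (P `|` (w |` (Q `\ u))).
  split.
    rewrite (cut_card C) cardfsU1 !inE (negPf wQ) andbF (cardfsD1 u Q).
    by rewrite (proj1 uQ).
  (* The cell [u] taken out of [Q] is still in [P], so the whole of [Q] may be put back. *)
  have -> : P `|` (w |` (Q `\ u)) = (P `|` [fset w]) `|` Q.
    apply/fsetP => c; rewrite !inE; case: (c =P u) => [->|_] /=; last by rewrite orbA.
    by rewrite (proj1 uP).
  apply: (@edge_connectedU _ _ u u) => //; rewrite ?eqxx //.
  - apply: (@edge_connectedU _ _ u w) => //; rewrite ?uw ?orbT ?inE //.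
      exact: edge_connected1.
    exact: (proj1 uP).
  - by rewrite inE (proj1 uP).
  - exact: (proj1 uQ).
apply: DecodesShareMax C Pc _ u2 _ _ => //.
apply/fsetP => c; rewrite !inE; case: (c =P u) => [->|_] /=; first exact: (proj1 uQ).
by case: eqP => // ->; rewrite (negPf wQ).
Qed.

(** If [P] were a single cell, the first part would be just the added down cell: connected, and
    followed by the up cell [v] in the same strip, which is the pattern of [DecodesShareMax]. *)
Lemma decodes_share_min P Q v : edge_connected P -> edge_connected Q ->
  (1 < #|` P|)%N ->
  greatest v P -> least v Q -> ~~ v.2 -> {in column v.1.1 P, forall c : cell, ~~ c.2} ->
  exists2 R, polyiamond (#|` P| + #|` Q|) R & decodes #|` P| R P Q.
Proof.
move=> Pc Qc P1 vP vQ v2 Pcol.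
have vcol : v \in column v.1.1 P by rewrite mem_column (proj1 vP) eqxx.
have [b [bcol bM]] := exists_least vcol.
have [bP bx] : b \in P /\ b.1.1 = v.1.1.
  by move: bcol; rewrite mem_column => /andP[-> /eqP].
have b2 : ~~ b.2 := Pcol _ bcol.
pose e : cell := (v.1.1, b.1.2 - 1, true)%R.
have be : adj b e.
  move: b2 bx; rewrite /e; case: (b) => [[x y] []] //= _ <-.
  by rewrite /adj_up_down !xpair_eqE /=; lia.
have eb (c : cell) : c \in column v.1.1 P -> ~~ cle c e.
  move=> cc; have := bM _ cc; have := Pcol _ cc; move: cc bx b2.
  rewrite mem_column /e /cle /height /=.
  by case: (b) (c) => [[x y] []] [[x' y'] []] //=; lia.
have eP : e \notin P.
  apply/negP => eP; have := Pcol e; rewrite mem_column eP eqxx => /(_ isT).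
  exact/negP/negPn.
(* The shared cell [v] is left to [Q], and [e] replaces it, so [F] has as many cells as [P]. *)
set F := e |` (P `\ v).
have eF : least e (column v.1.1 F).
  split=> [|c]; first by rewrite mem_column !inE !eqxx.
  rewrite mem_column !inE => /andP[/predU1P[->|/andP[_ cP]] cx].
    by have := cle_total e e; rewrite orbb.
  have := eb c; rewrite mem_column cP cx => /(_ isT).
  by case/orP: (cle_total c e) => ->.
have ev : cle e v by case/orP: (cle_total e v) => // /(negP (eb v vcol)).
have [u uF] : exists u, greatest u F by apply: (@exists_greatest _ e); rewrite !inE eqxx.
have uv : cle u v.
  by have := proj1 uF; rewrite !inE => /predU1P[->//|/andP[_ /(proj2 vP)]].
have vu : ~~ cle v u.
  apply/negP => vu; have uE : u = v by apply: cle_anti; rewrite uv.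
  have := proj1 uF; rewrite uE !inE eqxx /= orbF => /eqP vE.
  by rewrite vE in v2.
have C : cut #|` P| (F `|` Q) F Q u v.
  split=> //; rewrite cardfsU1 !inE (negPf eP) andbF (cardfsD1 v P).
  by rewrite (proj1 vP).
exists (F `|` Q).
  split; first exact: cut_card C.
  have -> : F `|` Q = (P `|` [fset e]) `|` Q.
    apply/fsetP => c; rewrite !inE; case: (c =P v) => [->|_] /=.
      by rewrite (proj1 vQ) !orbT.
    by rewrite [(c == e) || _]orbC.
  apply: (@edge_connectedU _ _ v v) => //; rewrite ?eqxx //.
  - apply: (@edge_connectedU _ _ b e) => //; rewrite ?be ?orbT ?inE //.
    exact: edge_connected1.
  - by rewrite inE (proj1 vP).
  - exact: (proj1 vQ).
apply: (DecodesShareMin C _ eF); last first.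
  apply/fsetP => c; rewrite !inE; case: (c =P v) => [->|_] /=; first exact: (proj1 vP).
  by case: eqP => // ->; rewrite (negPf eP).
have [uE|ue] := eqVneq u e; last first.
  (* Since [e], [u], [v] are in increasing order, [u] lies in the strip of [v], where [P] has only
     up cells. *)
  right; have uP : u \in P by have := proj1 uF; rewrite !inE (negPf ue) => /andP[].
  have ux : u.1.1 = v.1.1.
    have := proj2 uF e; rewrite !inE eqxx => /(_ isT).
    by move=> /cle_column/(_ uv); apply.
  by split=> //; apply: Pcol; rewrite mem_column uP ux eqxx.
(* Here e is the only cell of F in its strip, so no other cell of F touches it. *)
left=> Fc.
have eF0 : e \in F by rewrite !inE eqxx.
have [c] : exists c, c \in P `\ v.
  apply/fset0Pn; rewrite -cardfs_gt0.
  by move: P1; rewrite (cardfsD1 v P) (proj1 vP).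
move=> cPv; have cF : c \in F by rewrite inE cPv orbT.
have ec : c != e by apply: contraNneq eP => <-; move: cPv; rewrite inE => /andP[].
have [[|d p] [pp pc pF]] := Fc _ _ eF0 cF; first by rewrite -pc /= eqxx in ec.
case/andP: pp => ed _; case/andP: pF => dF _.
(* The neighbour [d] of the down cell [e] is at most [e], hence in its strip; but there every cell
   of [P] is above [e]. *)
have := proj2 uF _ dF; rewrite uE => de.
have dne : d != e by apply: contraTneq ed => ->; rewrite /e /=.
have dP : d \in P by move: dF; rewrite !inE (negPf dne) => /andP[].
by have := eb d; rewrite mem_column dP (adj_cle_column ed isT de) eqxx de => /(_ isT).
Qed.

(** * Choosing a construction for each pair *)

Lemma exists_decodes l m P Q : (1 < l)%N -> (0 < m)%N ->
  polyiamond l P -> polyiamond m Q ->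
  exists R a b, polyiamond (l + m) R /\ decodes l R P (translate a b Q).
Proof.
move=> l1 m0 [Pl Pc] [Qm Qc].
have [p0 p0P] : exists c, c \in P by apply/fset0Pn; rewrite -cardfs_gt0 Pl ltnW.
have [q0 q0Q] : exists c, c \in Q by apply/fset0Pn; rewrite -cardfs_gt0 Qm.
have [u uP] := exists_greatest p0P; have [v vQ] := exists_least q0Q.
suff [a [b [R RR RD]]] : exists a b, exists2 R,
    polyiamond (#|` P| + #|` translate a b Q|) R & decodes #|` P| R P (translate a b Q).
  by exists R, a, b; rewrite -Pl -Qm -(card_translate a b Q).
have tQc a b : edge_connected (translate a b Q) by exact: edge_connected_translate.
have side (p q : cell) : p \in P -> p.1.1 = u.1.1 -> p.2 ->
    q \in Q -> q.1.1 = v.1.1 -> ~~ q.2 ->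
    exists a b, exists2 R, polyiamond (#|` P| + #|` translate a b Q|) R &
      decodes #|` P| R P (translate a b Q).
  (* [q] is moved to the neighbour of [p] in the next strip, so all of [Q] lies in strips after
     those of [P]. *)
  move=> pP px p2 qQ qx q2; pose a := (p.1.1 + 1 - q.1.1)%R; pose b := (p.1.2 - q.1.2)%R.
  exists a, b.
  apply: (decodes_glue Pc (tQc a b) uP (least_translate a b vQ) _ _
            pP (q := shift a b q)).
  - by rewrite /cle /a /=; lia.
  - by rewrite /a /=; apply/orP; left; lia.
  - by rewrite (mem_shift_translate a b q).
  - move: p2 q2; rewrite /a /b; case: (p) (q) => [[x y] []] [[x' y'] []] //= _ _.
    by rewrite /adj_up_down !xpair_eqE /=; lia.
have [u2|u2] := boolP u.2.
  have [[q [qQ qx q2]]|noq] :=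
    classic (exists q : cell, [/\ q \in Q, q.1.1 = v.1.1 & ~~ q.2]).
    by apply: (side u q) => //; exact: (proj1 uP).
  have v2 : v.2 by apply: contra_notT noq => v2; exists v; split=> //; exact: (proj1 vQ).
  pose a := (u.1.1 - v.1.1)%R; pose b := (u.1.2 - v.1.2)%R; exists a, b.
  have vu : shift a b v = u.
    move: u2 v2; rewrite /a /b /shift; case: (u) (v) => [[x y] []] [[x' y'] []] //= _ _.
    by congr (_, _, _); lia.
  apply: (decodes_share_max Pc (tQc a b) uP _ u2).
    by rewrite -{1}vu; exact: least_translate.
  move=> c; rewrite mem_column mem_translate => /andP[cQ /eqP cx].
  apply: contra_notT noq => c2; exists (shift (- a) (- b) c); split=> //=.
  by rewrite cx /a; lia.
have [v2|v2] := boolP v.2.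
  (* At the coordinates of [u], the down cell [v] sits directly above the up cell [u]. *)
  pose a := (u.1.1 - v.1.1)%R; pose b := (u.1.2 - v.1.2)%R; exists a, b.
  apply: (decodes_glue Pc (tQc a b) uP (least_translate a b vQ) _ _
            (proj1 uP) (q := shift a b v)).
  - move: u2 v2; rewrite /a /b /cle /height.
    case: (u) (v) => [[x y] []] [[x' y'] []] //= _ _.
    by lia.
  - by rewrite /= u2 v2 orbT.
  - by rewrite (mem_shift_translate a b v); exact: (proj1 vQ).
  - move: u2 v2; rewrite /a /b; case: (u) (v) => [[x y] []] [[x' y'] []] //= _ _.
    by rewrite /adj_up_down !xpair_eqE /=; lia.
have [[p [pP px p2]]|nop] :=
    classic (exists p : cell, [/\ p \in P, p.1.1 = u.1.1 & p.2]).
  by apply: (side p v) => //; exact: (proj1 vQ).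
pose a := (u.1.1 - v.1.1)%R; pose b := (u.1.2 - v.1.2)%R; exists a, b.
have vu : shift a b v = u.
  move: u2 v2; rewrite /a /b /shift; case: (u) (v) => [[x y] []] [[x' y'] []] //= _ _.
  by congr (_, _, _); lia.
apply: (decodes_share_min Pc (tQc a b) _ uP _ u2).
- by rewrite Pl.
- by rewrite -{1}vu; exact: least_translate.
- move=> c; rewrite mem_column => /andP[cP /eqP cx].
  by apply/negP => c2; apply: nop; exists c.
Qed.

(** * Finiteness of the set of classes *)

(** Coordinates run from -n to n, as ordinals below 2n+1 lowered by n. *)
Definition box (n : nat) : {fset cell} :=
  [fset ((Posz (c.1.1 : 'I_n.*2.+1) - Posz n)%R,
         (Posz (c.1.2 : 'I_n.*2.+1) - Posz n)%R, c.2)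
     | c in {: 'I_n.*2.+1 * 'I_n.*2.+1 * bool}].

Lemma mem_box n (c : cell) :
  (`|c.1.1| <= Posz n)%R -> (`|c.1.2| <= Posz n)%R -> c \in box n.
Proof.
case: c => [[x y] b] /= hx hy; apply/imfsetP => /=.
exists (inord `|(x + Posz n)%R|, inord `|(y + Posz n)%R|, b) => //=.
by rewrite !inordK; [congr (_, _, _); lia | lia | lia].
Qed.

Lemma adj_path_bound (c : cell) (p : seq cell) : path adj c p ->
  (`|(last c p).1.1 - c.1.1| <= Posz (size p))%R /\
  (`|(last c p).1.2 - c.1.2| <= Posz (size p))%R.
Proof.
elim: p c => [|d p IH] c /=; first by rewrite !subrr.
case/andP=> cd /IH.
have [] : (`|d.1.1 - c.1.1| <= 1)%R /\ (`|d.1.2 - c.1.2| <= 1)%R.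
  by move: cd; case: c d => [[x y] []] [[x' y'] []] //=; rewrite /adj_up_down !xpair_eqE /=; lia.
by lia.
Qed.

Lemma polyiamond_sub_box n P (v : cell) :
  polyiamond n P -> v \in P -> v.1 = (0%R, 0%R) -> P `<=` box n.
Proof.
move=> [Pn Pc] vP v0; apply/fsubsetP => c cP.
have [p [pp pc pP]] := Pc _ _ vP cP.
(* Without repetitions the path has at most [n] steps. *)
case/shortenP: pp pc => q pq uq qp pc.
have qn : (size q <= n)%N.
  rewrite -Pn; apply: uniq_leq_size; first by case/andP: uq.
  by move=> d /qp /(allP pP).
have [] := adj_path_bound pq; rewrite pc v0 /= !subr0 => hx hy.
by apply: mem_box; [apply: le_trans hx _ | apply: le_trans hy _]; rewrite lez_nat.
Qed.

(** A canonical representative of each class; the orientation of the least cell stays free. *)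
Definition normalized (n : nat) (P : {fset cell}) : Prop :=
  polyiamond n P /\ exists2 v, least v P & v.1 = (0%R, 0%R).

Lemma normalized_uniq n P Q :
  normalized n P -> normalized n Q -> transl_equiv P Q -> P = Q.
Proof.
move=> [_ [v vP v0]] [_ [w wQ w0]] [a [b QE]].
have := least_translate a b vP; rewrite -QE => /least_uniq/(_ wQ) E.
move: w0; rewrite -E /shift v0 /= !add0r => -[a0 b0].
by rewrite QE a0 b0 translate0.
Qed.

Lemma exists_normalized n P : (0 < n)%N -> polyiamond n P ->
  exists2 Q, normalized n Q & transl_equiv P Q.
Proof.
move=> n0 Pn; have [c cP] : exists c, c \in P.
  by apply/fset0Pn; rewrite -cardfs_gt0 Pn.1.
have [v vP] := exists_least cP.
exists (translate (- v.1.1) (- v.1.2) P); last by exists (- v.1.1)%R, (- v.1.2)%R.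
split; first exact: polyiamond_translate.
exists (shift (- v.1.1) (- v.1.2) v); first exact: least_translate.
by rewrite /shift /= !subrr.
Qed.

Lemma num_classes_T n : (0 < n)%N -> num_classes_is n (T n).
Proof.
(* It suffices that some count exists; listing the normalized polyiamonds provides one. *)
move=> n0; apply: epsilon_spec.
pose A := [fset P in fpowerset (box n) | excluded_middle_informative (normalized n P)].
have memA P : P \in A <-> normalized n P.
  rewrite !inE /=; case: excluded_middle_informative => [nP|nP]; last by rewrite andbF.
  rewrite andbT; split=> // _; have [Pn [v [vP _] v0]] := nP.
  by rewrite fpowersetE; apply: polyiamond_sub_box v0.
exists #|` A|, (fun i => nth fset0 A i).
have nthA (i : 'I_#|` A|) : normalized n (nth fset0 A i) by apply/memA/mem_nth.
split=> [i|i j ij|P Pn]; first by case: (nthA i).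
  apply/val_inj/eqP; rewrite -(nth_uniq fset0 (ltn_ord i) (ltn_ord j) (fset_uniq A)).
  by apply/eqP/(normalized_uniq (nthA i) (nthA j)).
have [Q /memA QA PQ] := exists_normalized n0 Pn.
have iQ : (index Q A < #|` A|)%N by rewrite index_mem.
by exists (Ordinal iQ); rewrite /= nth_index.
Qed.

(** * The injection on pairs of classes *)

Lemma leq_mul_T l m : (1 < l)%N -> (0 < m)%N -> (T l * T m <= T (l + m))%N.
Proof.
move=> l1 m0.
have [f [fP f_inj _]] := num_classes_T (ltnW l1).
have [g [gP g_inj _]] := num_classes_T m0.
have [h [_ _ h_onto]] : num_classes_is (l + m) (T (l + m)).
  by apply: num_classes_T; rewrite addn_gt0 m0 orbT.
(* To each pair of classes a class of glued polyiamonds is assigned; its representative decodes into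
   translates of the two pieces. *)
have /fin_all_exists[k kP] : forall ij : 'I_(T l) * 'I_(T m), exists k : 'I_(T (l + m)),
    exists P Q, [/\ transl_equiv (f ij.1) P, transl_equiv (g ij.2) Q &
      decodes l (h k) P Q].
  move=> [i j].
  have [R [a [b [RR D]]]] := exists_decodes l1 m0 (fP i) (gP j).
  have [k [c [d E]]] := h_onto R RR; exists k.
  exists (translate c d (f i)), (translate c d (translate a b (g j))); split.
  - by exists c, d.
  - by exists (a + c)%R, (b + d)%R; rewrite translateD.
  - by rewrite E; apply: decodes_translate.
have k_inj : injective k.
  move=> [i j] [i' j'] E.
  have [P [Q [fi gj D]]] := kP (i, j); have [P' [Q' [fi' gj' D']]] := kP (i', j').
  (* The same representative decodes in one way only, so the pieces agree up to translation. *)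
  rewrite E in D; have [PP' QQ'] := decodes_uniq D D'; subst P' Q'.
  by congr (_, _); [apply: f_inj; apply: transl_equiv_trans fi (transl_equiv_sym fi')
                  | apply: g_inj; apply: transl_equiv_trans gj (transl_equiv_sym gj')].
by have := leq_card k k_inj; rewrite card_prod !card_ord.
Qed.

Theorem theorem4 (l m : nat) :
  (1 <= l)%N -> (1 <= m)%N -> ~ (l = 1%N /\ m = 1%N) ->
  (T l * T m <= T (l + m))%N.
Proof.
move=> l1 m1 lm; have [l2|l2] := ltnP 1 l; first exact: leq_mul_T.
by rewrite mulnC addnC; apply: leq_mul_T; lia.
Qed.
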